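(* Let $k \geq 2$ be an integer. Then: (i) $T_n(k) = \sum_{j=1}^{k-1} B_n(k,j)$ for all $n \geq 0$. (ii) $S_n(k) = \sum_{j=0}^{k-1} B_n(k,j)$ for all $n \geq 0$. (iii) For every integer $j$ with $0 \leq j \leq k-1$, $B_n(k,j) = \frac{1}{k-1} \left(S_n(k) - S_{n-j-1}(k)\right)$ for all $n \geq j+1$.
   Context: Fix an integer $k \geq 2$. All of the following sequences satisfy the $k$-order Fibonacci recurrence $X_n = X_{n-1}+X_{n-2}+\dots+X_{n-k}$ for all $n \geq k$, and are determined by their first $k$ terms (indices $0,\dots,k-1$): $\{T_n(k)\}_{n \geq 0}$ has first $k$ terms $(0,1,1,\dots,1)$; $\{S_n(k)\}_{n \geq 0}$ has first $k$ terms $(1,1,\dots,1)$; and, for $0 \leq j \leq k-1$, $\{B_n(k,j)\}_{n\geq 0}$ has $B_j(k,j)=1$ and $B_i(k,j)=0$ for $0 \leq i \leq k-1$, $i\neq j$. *)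

(* Defs.v *)
From mathcomp Require Import all_boot.

Set Implicit Arguments.
Unset Strict Implicit.
Unset Printing Implicit Defensive.

Local Open Scope nat_scope.

(* The list [:: X_(n-1); ...; X_1; X_0] of the first n terms, latest first, of
   the sequence X with X_m = a m for m < k and, for m >= k,
   X_m = X_(m-1) + ... + X_(m-k); see kfib_init and kfib_rec. *)
Fixpoint kfib_terms (k : nat) (a : nat -> nat) (n : nat) : seq nat :=
  if n is m.+1 then
    let s := kfib_terms k a m in
    (if m < k then a m else sumn (take k s)) :: s
  else [::].

Definition kfib (k : nat) (a : nat -> nat) (n : nat) : nat :=
  head 0 (kfib_terms k a n.+1).

Definition kfibT (k n : nat) : nat := kfib k (fun i => if i == 0 then 0 else 1) n.

Definition kfibS (k n : nat) : nat := kfib k (fun _ => 1) n.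

Definition kfibB (k j n : nat) : nat :=
  kfib k (fun i => if i == j then 1 else 0) n.

Lemma kfib_init (k : nat) (a : nat -> nat) (n : nat) :
  n < k -> kfib k a n = a n.
Proof. by rewrite /kfib /= => ->. Qed.

Lemma size_kfib_terms (k : nat) (a : nat -> nat) (n : nat) :
  size (kfib_terms k a n) = n.
Proof. by elim: n => //= n ->. Qed.

Lemma nth_kfib_terms (k : nat) (a : nat -> nat) (n i : nat) :
  i < n -> nth 0 (kfib_terms k a n) i = kfib k a (n - i.+1).
Proof.
elim: n i => // n IHn [|i] lt_in; first by rewrite subSS subn0.
by rewrite subSS -IHn.
Qed.

Lemma kfib_rec (k : nat) (a : nat -> nat) (n : nat) :
  k <= n -> kfib k a n = \sum_(1 <= i < k.+1) kfib k a (n - i).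
Proof.
move=> le_kn; rewrite {1}/kfib /= ltnNge le_kn /= sumnE (big_nth 0).
rewrite size_takel ?size_kfib_terms // big_add1 /=.
apply: eq_big_nat => i /andP[_ lt_ik].
by rewrite nth_take // nth_kfib_terms // (leq_trans lt_ik).
Qed.

(* Main.v *)
(* The sequences satisfying the recurrence are determined by their first k
   terms, so (i) and (ii) only need to be compared for n < k.  For (iii), the
   recurrence can be run backwards: it extends S to the indices -k, ..., -1 by
   S_(-1) = 2 - k and S_(-i) = 1 for 2 <= i <= k.  Then n |-> S_n - S_(n-j-1)
   satisfies the recurrence for n >= k, and for 0 <= n < k it vanishes except
   at n = j, where its value is 1 - (2 - k) = k - 1. *)
Require Import Defs.
From mathcomp Require Import all_boot all_order all_algebra.
From mathcomp Require Import zify ring.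

Import GRing.Theory.

(** Generic in the operation, to serve both the [nat] sequences and the [rat]-valued backward
    extension of S. *)
Definition kfib_recurrence {T : Type} (op : T -> T -> T) (x0 : T) (k : nat)
    (f : nat -> T) : Prop :=
  forall n, k <= n -> f n = \big[op/x0]_(1 <= i < k.+1) f (n - i).

Lemma kfib_recurrence_unique {T : Type} (op : T -> T -> T) (x0 : T) (k : nat)
    (f g : nat -> T) :
    kfib_recurrence op x0 k f -> kfib_recurrence op x0 k g ->
    (forall n, n < k -> f n = g n) ->
  f =1 g.
Proof.
move=> fE gE init; elim/ltn_ind=> n IHn.
have [/init//|le_kn] := ltnP n k.
rewrite fE // gE //; apply: eq_big_nat => i /andP[i_gt0 lt_ik].
by apply: IHn; lia.
Qed.

Lemma kfib_recurrence_sum (k : nat) (r : seq nat) (a : nat -> nat -> nat) :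
  kfib_recurrence addn 0 k (fun n => \sum_(j <- r) kfib k (a j) n).
Proof.
move=> n le_kn; rewrite exchange_big /=.
by apply: eq_bigr => j _; apply: kfib_rec.
Qed.

Lemma sum_indicator (m k n : nat) :
  \sum_(m <= j < k) (if n == j then 1 else 0) = (m <= n < k) :> nat.
Proof.
rewrite -big_mkcond /= sum1_count (eq_count (a2 := pred1 n)); last first.
  by move=> j /=; rewrite eq_sym.
by rewrite count_uniq_mem ?iota_uniq // mem_index_iota.
Qed.

(** Covers (i) with [m = 1] and (ii) with [m = 0]. *)
Lemma kfib_sum_kfibB (m k n : nat) :
  kfib k (fun i => if i < m then 0 else 1) n = \sum_(m <= j < k) kfibB k j n.
Proof.
move: n; apply: (kfib_recurrence_unique addn 0 k).
- exact: kfib_rec.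
- exact: kfib_recurrence_sum.
move=> n lt_nk; rewrite kfib_init //.
under eq_bigr do rewrite /kfibB kfib_init //.
by rewrite sum_indicator lt_nk andbT ltnNge; case: (m <= n).
Qed.

Local Open Scope ring_scope.

(* Shifted index: [kfibS_ext k m] is the term of index m - k of the backward
   extension of [kfibS k]. *)
Definition kfibS_ext (k m : nat) : rat :=
  if (m < k)%N then (if m.+1 == k then 2 - k%:R else 1)
  else (kfibS k (m - k))%:R.

Lemma kfibS_ext_shift (k n : nat) : kfibS_ext k (n + k) = (kfibS k n)%:R.
Proof. by rewrite /kfibS_ext ltnNge leq_addl addnK. Qed.

(** For [n < k], the [k] terms before S_n include S_(-1) exactly once and are otherwise 1, so they
    sum to (k - 1) + (2 - k) = 1. *)
Lemma kfibS_ext_rec (k : nat) : kfib_recurrence +%R 0 k (kfibS_ext k).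
Proof.
move=> m le_km; have [n ->] : exists n, m = (n + k)%N by exists (m - k)%N; lia.
rewrite kfibS_ext_shift; have [lt_nk|le_kn] := ltnP n k; last first.
  rewrite /kfibS kfib_rec // natr_sum; apply: eq_big_nat => i /andP[i_gt0 lt_ik].
  by rewrite -kfibS_ext_shift; congr kfibS_ext; lia.
rewrite /kfibS kfib_init //.
(* The offset [i = n.+1] is the one that reaches S_(-1) = 1 + (1 - k). *)
have extE i : (1 <= i < k.+1)%N ->
    kfibS_ext k (n + k - i) = 1 + (if n.+1 == i then 1 - k%:R else 0).
  move=> /andP[i_gt0 lt_ik]; rewrite /kfibS_ext.
  have [le_in|lt_ni] := leqP i n.
    have -> : (n + k - i < k)%N = false by lia.
    have -> : (n.+1 == i) = false by lia.
    by rewrite /kfibS kfib_init ?addr0 //; lia.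
  have -> : (n + k - i < k)%N by lia.
  have -> : ((n + k - i).+1 == k) = (n.+1 == i) by lia.
  by case: eqP => _; ring.
rewrite (eq_big_nat _ _ extE) big_split /= sumr_const_nat.
rewrite (bigD1_seq n.+1) ?iota_uniq ?mem_index_iota //= eqxx.
rewrite big1 => [|i /negPf]; last by rewrite eq_sym => ->.
by rewrite subSS subn0; ring.
Qed.

(** Since [j < k], the shifted index [n + k - j.+1] is never truncated, so both sides can be
    compared from [n = 0] on. *)
Lemma kfibB_kfibS_ext (k j n : nat) : (j < k)%N ->
  (k%:R - 1) * (kfibB k j n)%:R =
    kfibS_ext k (n + k) - kfibS_ext k (n + k - j.+1).
Proof.
move=> lt_jk; move: n; apply: (kfib_recurrence_unique +%R 0 k).
- by move=> n le_kn; rewrite /kfibB kfib_rec // natr_sum mulr_sumr.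
- move=> n le_kn; rewrite !(kfibS_ext_rec k) -?sumrB; try lia.
  apply: eq_big_nat => i /andP[i_gt0 lt_ik].
  by congr (kfibS_ext k _ - kfibS_ext k _); lia.
move=> n lt_nk; rewrite kfibS_ext_shift /kfibB /kfibS !kfib_init //.
(* For [n <= j] the index n - j - 1 is negative, and equals -1 only at [n = j]; for [j < n] both
   terms are initial values 1 of S. *)
rewrite /kfibS_ext; have [le_nj|lt_jn] := leqP n j.
  have -> : (n + k - j.+1 < k)%N by lia.
  have -> : ((n + k - j.+1).+1 == k) = (n == j) by lia.
  by case: eqP => _; ring.
have -> : (n + k - j.+1 < k)%N = false by lia.
have -> : (n == j) = false by lia.
by rewrite /kfibS kfib_init; [ring | lia].
Qed.

Local Close Scope ring_scope.

Theorem lemma3 (k : nat) (hk : (2 <= k)%N) :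
  [/\ (forall n : nat, kfibT k n = (\sum_(1 <= j < k) kfibB k j n)%N),
      (forall n : nat, kfibS k n = (\sum_(0 <= j < k) kfibB k j n)%N)
    & (forall j : nat, (0 <= j <= k - 1)%N ->
       forall n : nat, (j + 1 <= n)%N ->
         (((kfibB k j n)%:R : rat) =
            1 / (k%:R - 1) *
              ((kfibS k n)%:R - (kfibS k (n - j - 1))%:R))%R)].
Proof.
split=> [n|n|j /andP[_ le_jk] n lt_jn].
- rewrite -kfib_sum_kfibB; move: n.
  apply: (kfib_recurrence_unique addn 0 k); try exact: kfib_rec.
  by move=> n lt_nk; rewrite /kfibT !kfib_init //; case: n {lt_nk}.
- exact: (kfib_sum_kfibB 0).
have k1_neq0 : (k%:R - 1 != 0 :> rat)%R.
  by rewrite subr_eq0 -[1%R]/(1%:R)%R Num.Theory.eqr_nat; lia.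
apply: (mulfI k1_neq0); rewrite kfibB_kfibS_ext; last lia.
(* As [j < n], both indices lie in the range where the extension is S itself. *)
have -> : n + k - j.+1 = n - j - 1 + k by lia.
by rewrite !kfibS_ext_shift mul1r mulVKf.
Qed.
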